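(* Let $m\ge1$ and let $T$ be an $(m+1)$-ary tree of size $n$. Then $\mathcal B^{(m)}_T(x)=\sum_{T'} x^{\lambda(T')}$, where the sum runs over the $(m+1)$-ary trees $T'$ of size $n$ with $T'\le T$ in the $m$-Tamari lattice $\mathcal T^{(m)}_n$, and $\lambda(T')$ is the number of nodes on the left branch of $T'$ (equivalently, the number of returns of the $m$-ballot path of $T'$ to the line $y=x/m$). In particular $\mathcal B^{(m)}_T(1)$ is the number of elements $\le T$ in $\mathcal T^{(m)}_n$.
   Context: An $m$-ballot path of size $n$ is a lattice path from $(0,0)$ to $(mn,n)$ with up steps $(0,1)$ (letter $1$) and horizontal steps $(1,0)$ (letter $0$), never going below the line $y=x/m$. A nonempty path is primitive if it touches the line $y=x/m$ only at its two endpoints. A rotation: if the path (as a word) contains a horizontal step $0$ immediately followed by a factor $c$ which, translated to start at the origin, is a primitive $m$-ballot path, exchange the $0$ and $c$. The $m$-Tamari order $\mathcal T^{(m)}_n$ is the reflexive-transitive closure of rotations ($D\le D'$ if $D'$ is obtained from $D$ by rotations). The number of returns of a path is its number of contacts with $y=x/m$ other than the origin. An $(m+1)$-ary tree is empty or a root with an ordered list of $m+1$ subtrees $T_L,T_{R_1},\dots,T_{R_m}$; its size is its number of nodes; its left branch is the sequence of nodes obtained from the root by repeatedly going to the first subtree $T_L$. Trees correspond bijectively to $m$-ballot paths via $D(\emptyset)=\emptyset$, $D(T)=D(T_L)\,1\,D(T_{R_m})\,0\,D(T_{R_{m-1}})\,0\cdots0\,D(T_{R_1})\,0$; the order $\mathcal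 T^{(m)}_n$ is transported to trees through this bijection. Let $\Delta(g)=\frac{xg(x)-g(1)}{x-1}$ and define $\mathcal B^{(m)}_\emptyset=1$ and $\mathcal B^{(m)}_T=x\,\mathcal B^{(m)}_{T_L}\,\Delta\bigl(\mathcal B^{(m)}_{T_{R_1}}\,\Delta(\mathcal B^{(m)}_{T_{R_2}}\,\Delta(\cdots\Delta(\mathcal B^{(m)}_{T_{R_m}})\cdots))\bigr)$. *)

(* Defs.v *)
From HB Require Import structures.
From mathcomp Require Import all_boot all_order all_algebra.
Set Implicit Arguments.
Unset Strict Implicit.
Unset Printing Implicit Defensive.
Import Order.TTheory GRing.Theory Num.Theory.

(* [Node l r] is the tree with T_L = l and T_{R_(i+1)} = r i for i : 'I_m. *)
Unset Elimination Schemes.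
Inductive mtree (m : nat) : Type :=
  | Leaf
  | Node of mtree m & {ffun 'I_m -> mtree m}.
Set Elimination Schemes.
Arguments Leaf {m}.

Lemma mtree_ind (m : nat) (P : mtree m -> Prop) :
    P Leaf -> (forall l (r : {ffun _}), P l -> (forall i, P (r i)) -> P (Node l r)) ->
  forall t, P t.
Proof.
move=> PL PN; fix IH 1 => -[|l r]; first exact: PL.
by apply: PN => [|i]; apply: IH.
Qed.

Fixpoint tsize m (t : mtree m) : nat :=
  if t is Node l r then (tsize l + \sum_(i < m) tsize (r i)).+1 else 0.

(* The number of nodes on the left branch. *)
Fixpoint lambda m (t : mtree m) : nat :=
  if t is Node l _ then (lambda l).+1 else 0.

(* Trees of height at most d, used only to obtain the finType structures. *)
Fixpoint shallow (m d : nat) : finType :=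
  if d is d'.+1 then option (shallow m d' * {ffun 'I_m -> shallow m d'})%type
  else unit.

Fixpoint enc m d (t : mtree m) {struct d} : shallow m d :=
  match d return shallow m d with
  | 0 => tt
  | d'.+1 =>
    if t is Node l r then Some (enc d' l, [ffun i => enc d' (r i)]) else None
  end.

Fixpoint dec m d {struct d} : shallow m d -> mtree m :=
  match d return shallow m d -> mtree m with
  | 0 => fun _ => Leaf
  | d'.+1 => fun s =>
    if s is Some (l, r) then Node (dec l) [ffun i => dec (r i)] else Leaf
  end.

Lemma encK m d (t : mtree m) : tsize t <= d -> dec (enc d t) = t.
Proof.
elim: d t => [|d IHd] [|l r] //=; rewrite ltnS => le_d.
rewrite IHd ?(leq_trans (leq_addr _ _) le_d) //; congr Node.
apply/ffunP=> i; rewrite !ffunE IHd // (leq_trans _ le_d) //.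
by rewrite (bigD1 i) //= addnCA leq_addr.
Qed.

Definition mtree_code m (t : mtree m) : {d & shallow m d} :=
  Tagged (fun d => shallow m d) (enc (tsize t) t).
Definition mtree_decode m (c : {d & shallow m d}) : mtree m := dec (tagged c).

Lemma mtree_codeK m : cancel (@mtree_code m) (@mtree_decode m).
Proof. by move=> t; apply: encK. Qed.

HB.instance Definition _ m := Countable.copy (mtree m) (can_type (@mtree_codeK m)).

Record tree_of (m n : nat) : Type :=
  TreeOf { tval :> mtree m; tvalP : tsize tval == n }.

HB.instance Definition _ m n := [isSub of tree_of m n for @tval m n].
HB.instance Definition _ m n := [Countable of tree_of m n by <:].

Lemma tree_of_encK m n :
  pcancel (fun t : tree_of m n => enc n t)
          (fun s => insub (dec s) : option (tree_of m n)).
Proof. by move=> t; rewrite encK ?(eqP (tvalP t)) // valK. Qed.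

HB.instance Definition _ m n :=
  isFinite.Build (tree_of m n) (pcan_enumP (@tree_of_encK m n)).

(* Words over {1, 0} = {true, false}: true is the up step (0,1) and false the
   horizontal step (1,0). The endpoint (x, y) of a word is (number of false,
   number of true); it lies on y = x/m when x = m * y. *)
Definition on_line m (w : seq bool) : bool :=
  count_mem false w == m * count_mem true w.
Definition not_below m (w : seq bool) : bool :=
  count_mem false w <= m * count_mem true w.

Definition ballot m n (w : seq bool) : bool :=
  [&& count_mem false w == m * n, count_mem true w == n
    & all (fun i => not_below m (take i w)) (iota 0 (size w).+1)].

Definition primitive m (w : seq bool) : bool :=
  [&& w != [::], ballot m (count_mem true w) w
    & all (fun i => ~~ on_line m (take i w)) (iota 1 (size w).-1)].

(* A vertical step can meet y = x/m only at its starting point without going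
   below it, so all contacts are at lattice points, i.e. at ends of prefixes. *)
Definition returns m (w : seq bool) : nat :=
  count (fun i => on_line m (take i w)) (iota 1 (size w)).

Definition rotation m (w w' : seq bool) : bool :=
  has (fun i => has (fun j =>
      let u := take i w in
      let c := take j (drop i.+1 w) in
      let v := drop j (drop i.+1 w) in
      [&& w == u ++ false :: c ++ v, primitive m c & w' == u ++ c ++ false :: v])
    (iota 0 (size w).+1)) (iota 0 (size w).+1).

Lemma rotationP m w w' :
  reflect (exists u c v, [/\ w = u ++ false :: c ++ v, primitive m c
                           & w' = u ++ c ++ false :: v])
          (rotation m w w').
Proof.
apply: (iffP hasP) => [[i _ /hasP[j _ /and3P[/eqP Ew pc /eqP Ew']]]|].
  by exists (take i w), (take j (drop i.+1 w)), (drop j (drop i.+1 w)).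
case=> u [c [v [-> pc ->]]]; exists (size u).
  by rewrite mem_iota add0n !ltnS size_cat leq_addr.
have dropE : drop (size u).+1 (u ++ false :: c ++ v) = c ++ v.
  by rewrite -cat_rcons drop_size_cat // size_rcons.
apply/hasP; exists (size c).
  rewrite mem_iota add0n !ltnS !size_cat /= size_cat.
  by rewrite addnS -addSn addnCA leq_addr.
rewrite /= dropE !take_size_cat // drop_size_cat //.
by rewrite pc !eqxx.
Qed.

Record ballot_path (m n : nat) : Type :=
  BallotPath { bval :> (m * n + n).-tuple bool; bvalP : ballot m n bval }.

HB.instance Definition _ m n := [isSub of ballot_path m n for @bval m n].
HB.instance Definition _ m n := [Finite of ballot_path m n by <:].

(* The order T_n^(m); [connect] is the reflexive-transitive closure. *)
Definition tamari_le m n : rel (ballot_path m n) :=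
  connect (fun D D' : ballot_path m n => rotation m D D').

(* D(T) = D(T_L) 1 D(T_{R_m}) 0 D(T_{R_(m-1)}) 0 ... D(T_{R_1}) 0 *)
Fixpoint word_of m (t : mtree m) : seq bool :=
  if t is Node l r then
    word_of l ++ true ::
      flatten [seq rcons (word_of (r i)) false | i <- rev (enum 'I_m)]
  else [::].

(* Reads w from height h = m * y - x; None when the path goes below the line. *)
Fixpoint run m h (w : seq bool) : option nat :=
  match w with
  | [::] => Some h
  | true :: w' => run m (h + m) w'
  | false :: w' => if h is h'.+1 then run m h' w' else None
  end.

Lemma run_cat m h u v : run m h (u ++ v) = obind (run m ^~ v) (run m h u).
Proof. by elim: u h => [|[] u IHu] [|h] //=. Qed.

Lemma run_count m h h' w : run m h w = Some h' ->
  h + m * count_mem true w = h' + count_mem false w.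
Proof.
elim: w h => [|[] w IHw] h /=; first by case=> ->; rewrite muln0.
  by move/IHw; rewrite mulnDr muln1 add0n addnA.
by case: h => // h /IHw E; rewrite add0n addSn E addnCA.
Qed.

Lemma run_not_below m h w i : run m 0 w = Some h -> not_below m (take i w).
Proof.
rewrite -{1}(cat_take_drop i w) run_cat.
case E: (run m 0 (take i w)) => [h'|] //= _.
by rewrite /not_below -[m * _]add0n (run_count E) leq_addl.
Qed.

Lemma run_word_of m h (t : mtree m) : run m h (word_of t) = Some h.
Proof.
elim/mtree_ind: t h => [|l r IHl IHr] h //=; rewrite run_cat IHl /=.
have runs s k : size s = k ->
    run m (h + k) (flatten [seq rcons (word_of (r i)) false | i <- s]) = Some h.
  elim: s k => [|i s IHs] [|k] //= => [_|[sz]]; first by rewrite addn0.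
  by rewrite run_cat -cats1 run_cat IHr /= addnS; apply: IHs.
by apply: runs; rewrite size_rev size_enum_ord.
Qed.

Lemma count_word_of m (t : mtree m) : count_mem true (word_of t) = tsize t.
Proof.
elim/mtree_ind: t => [|l r IHl IHr] //=; rewrite count_cat /= IHl.
rewrite add1n addnS count_flatten -map_comp map_rev sumn_rev.
rewrite sumnE big_map big_enum /=; congr (_ + _).+1.
by apply: eq_big => // i _; rewrite -cats1 count_cat /= IHr ?addn0.
Qed.

Lemma ballot_word_of m (t : mtree m) : ballot m (tsize t) (word_of t).
Proof.
have run_t := run_word_of 0 t; apply/and3P; split.
- by rewrite -count_word_of -[m * _]add0n (run_count run_t).
- by rewrite count_word_of.
- by apply/allP=> i _; apply: run_not_below run_t.
Qed.

Lemma ballot_path_ofP m n (t : tree_of m n) : ballot m n (word_of t).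
Proof. by have := ballot_word_of t; rewrite (eqP (tvalP t)). Qed.

Lemma size_word_of m n (t : tree_of m n) : size (word_of t) == m * n + n.
Proof.
have /and3P[/eqP <- /eqP cT _] := ballot_path_ofP t.
rewrite -[X in _ + X]cT addnC -(count_predC (pred1 true)).
by apply/eqP; congr (_ + _); apply: eq_count => -[].
Qed.

Definition path_of m n (t : tree_of m n) : ballot_path m n :=
  @BallotPath m n (Tuple (size_word_of t)) (ballot_path_ofP t).

Definition tree_le m n : rel (tree_of m n) :=
  fun t t' => tamari_le (path_of t) (path_of t').

Local Open Scope ring_scope.

Definition Delta (g : {poly int}) : {poly int} :=
  ('X * g - (g.[1])%:P) %/ ('X - 1).

(* The division defining Delta is exact. *)
Lemma DeltaE (g : {poly int}) : Delta g * ('X - 1) = 'X * g - (g.[1])%:P.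
Proof.
have lc1 : lead_coef ('X - 1%:P : {poly int}) \is a GRing.unit.
  by rewrite lead_coefXsubC unitr1.
rewrite /Delta -polyC1 (Pdiv.IdomainUnit.divpK lc1) //.
by rewrite dvdp_XsubCl rootE !hornerE subrr.
Qed.

(* The fold is Delta (B_{R_1} * Delta (B_{R_2} * ... Delta (B_{R_m} * 1))). *)
Fixpoint B m (t : mtree m) : {poly int} :=
  if t is Node l r then
    'X * B l * foldr (fun i g => Delta (B (r i) * g)) 1 (enum 'I_m)
  else 1.

(* Main.v *)
(* Call a word balanced if it stays at nonnegative height m y - x and ends at
   height 0. Going down in the order means replacing u c 0 v by u 0 c v with c
   primitive, so the lower ideal of the word of Node l r can be built letter by
   letter. If w ends at its final level, a letter 0 appended to w can travel
   back over the primitive factors that end w: the words below w 0 are exactly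
   the u 0 v with v balanced and u v below w. A word uv with k trailing
   primitive factors thus contributes 1 + x + ... + x^k = Delta(x^k). Appending
   a balanced factor w' takes products of lower ideals, because a primitive
   factor cannot straddle the junction, and prepending the letter 1 contributes
   a factor x. This is the recursion defining B. *)
Require Import Defs.
From mathcomp Require Import all_boot all_order all_algebra.
From mathcomp Require Import zify ring.
Import Order.TTheory GRing.Theory Num.Theory.
Set Implicit Arguments.
Unset Strict Implicit.
Unset Printing Implicit Defensive.

(** * Words read as paths: heights, contacts and primitive factors *)

Lemma run_add (m h h' k : nat) (w : seq bool) :
  run m h w = Some h' -> run m (h + k) w = Some (h' + k).
Proof.
elim: w h => [|[] w IHw] h /=; first by case=> ->.
  by rewrite addnAC; apply: IHw.
by case: h => // h; rewrite addSn; apply: IHw.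
Qed.

Definition balanced (m : nat) (w : seq bool) : bool := run m 0 w == Some 0.

Lemma run_balanced (m h : nat) (w : seq bool) :
  balanced m w -> run m h w = Some h.
Proof. by move/eqP/(run_add h). Qed.

Lemma run_catI (m h h' : nat) (u v : seq bool) : run m h (u ++ v) = Some h' ->
  exists2 k, run m h u = Some k & run m k v = Some h'.
Proof. by rewrite run_cat; case: (run m h u) => //= k Ek; exists k. Qed.

Lemma run_catl_balanced (m h h' : nat) (u v : seq bool) : balanced m v ->
  run m h (u ++ v) = Some h' -> run m h u = Some h'.
Proof. by move=> bv /run_catI[k -> ]; rewrite run_balanced. Qed.

Lemma balanced_cat (m : nat) (u v : seq bool) :
  balanced m v -> balanced m (u ++ v) = balanced m u.
Proof.
move=> bv; rewrite /balanced run_cat; case: (run m 0 u) => //= k.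
by rewrite run_balanced.
Qed.

Lemma not_below_run (m h : nat) (w : seq bool) :
    (forall i, count_mem false (take i w) <=
               h + m * count_mem true (take i w)) ->
  exists h', run m h w = Some h'.
Proof.
elim: w h => [|[] w IHw] h wP /=; first by exists h.
  by apply: IHw => i; have := wP i.+1; rewrite /= mulnDr muln1 add0n addnA.
case: h wP => [|h] wP; first by have := wP 1; rewrite /= take0 /= muln0.
by apply: IHw => i; have := wP i.+1; rewrite /= add0n add1n addSn ltnS.
Qed.

Lemma ballot_balanced (m n : nat) (w : seq bool) :
  ballot m n w = balanced m w && (count_mem true w == n).
Proof.
apply/and3P/andP => [[c0 c1 /allP nb]|[/eqP bw c1]]; split=> //.
- have [h Eh] : exists h, run m 0 w = Some h.
    apply: not_below_run => i; rewrite add0n.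
    have [le_i|lt_i] := leqP i (size w).
      by apply: nb; rewrite mem_iota add0n ltnS.
    rewrite (take_oversize (ltnW lt_i)).
    have := nb (size w); rewrite take_size; apply.
    by rewrite mem_iota add0n ltnS leqnn.
  rewrite /balanced Eh; move: (run_count Eh).
  rewrite (eqP c1) (eqP c0) add0n => /eqP.
  by rewrite -{1}[m * n]add0n eqn_add2r => /eqP<-.
- by rewrite -(eqP c1) -[m * _]add0n (run_count bw).
- by apply/allP=> i _; apply: run_not_below bw.
Qed.

(* The number of contacts with the final level: the primitive factors that
   follow the first arrival at that level. *)
Fixpoint balanced_suffixes (m : nat) (w : seq bool) : nat :=
  if w is _ :: w' then balanced m w + balanced_suffixes m w' else 0.

Lemma balanced_suffixes_cat (m : nat) (u v : seq bool) : balanced m v ->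
  balanced_suffixes m (u ++ v) = balanced_suffixes m u + balanced_suffixes m v.
Proof.
move=> bv; elim: u => //= b u ->.
by rewrite addnA -cat_cons balanced_cat.
Qed.

(** The displayed letter 0 passes strictly below every height met in [u], so no suffix that starts
    before [v] can end at its own starting level. *)
Lemma balanced_suffixes_drop (m h : nat) (u v : seq bool) :
    balanced m v -> run m h u = Some 0 ->
  balanced_suffixes m (u ++ false :: v) = balanced_suffixes m v.
Proof.
move=> bv; elim: u h => [|b u IHu] h Eu //=.
have -> : balanced_suffixes m (u ++ false :: v) = balanced_suffixes m v.
  case: b Eu => /= [/IHu//|]; case: h => // h; exact: IHu.
suff -> : balanced m (b :: u ++ false :: v) = false by [].
apply/negP; rewrite -cat_rcons -cat_cons balanced_cat // -cats1 -cat_cons.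
move=> /eqP/run_catI[[|k] Ek //= _].
by move: (run_add h Ek); rewrite add0n Eu.
Qed.

Lemma balanced_suffixes_gt0 (m : nat) (w : seq bool) :
  balanced m w -> (0 < balanced_suffixes m w) = (w != [::]).
Proof. by case: w => //= b w ->. Qed.

(** A prefix ends at height 0 exactly when the remaining suffix is balanced. The successor accounts
    for the empty suffix, which [balanced_suffixes] does not count. *)
Lemma count_contacts (m h : nat) (w : seq bool) : run m h w = Some 0 ->
  count (fun i => h + m * count_mem true (take i w) ==
                  count_mem false (take i w)) (iota 0 (size w).+1)
  = (balanced_suffixes m w).+1.
Proof.
elim: w h => [|b w IHw] h Ew; first by case: Ew => /= ->; rewrite muln0.
rewrite -[iota _ _]/(0 :: iota (1 + 0) (size w).+1) iotaDl.
move: (iota 0 _) IHw => s IHw; rewrite /= count_map muln0 addn0 -addnS.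
congr (_ + _).
  congr (nat_of_bool _); apply/eqP/eqP => [h0|bw].
    by move: Ew; rewrite h0.
  by move: (run_balanced h (introT eqP bw)); rewrite Ew => -[].
case: b Ew => [|] /= Ew.
  rewrite -(IHw _ Ew); apply: eq_count => i /=.
  by rewrite mulnDr muln1 add0n addnA.
case: h Ew => // h Ew; rewrite -(IHw _ Ew); by apply: eq_count.
Qed.

Lemma returns_balanced (m : nat) (w : seq bool) :
  balanced m w -> returns m w = balanced_suffixes m w.
Proof.
(* The contact at the origin, absent from [returns], offsets the empty suffix. *)
move=> /eqP/count_contacts; rewrite /returns -[iota 0 _]/(0 :: iota 1 (size w)).
move: (iota 1 _) => s; rewrite /= take0 muln0 add1n => -[<-].
by apply: eq_count => i; rewrite /on_line eq_sym.
Qed.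

Lemma primitiveE (m : nat) (c : seq bool) :
  primitive m c = balanced m c && (balanced_suffixes m c == 1).
Proof.
rewrite /primitive ballot_balanced eqxx andbT.
have [bc|] := boolP (balanced m c); last by rewrite andbF.
rewrite -returns_balanced // /returns; case: c bc => // b c bc.
rewrite (all_predC (fun i => on_line m (take i (b :: c)))) has_count -leqNgt.
have -> : iota 1 (size (b :: c)) = iota 1 (size c) ++ [:: size (b :: c)].
  by rewrite -{1}[size (b :: c)]addn1 iotaD.
rewrite count_cat leqn0 /= take_size.
have -> : on_line m (b :: c).
  by rewrite /on_line; move: (run_count (eqP bc)); rewrite !add0n => ->.
by rewrite addn1 eqSS.
Qed.

Lemma primitive_balanced (m : nat) (c : seq bool) :
  primitive m c -> balanced m c.
Proof. by rewrite primitiveE => /andP[]. Qed.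

(** If [p] ended at height 0, both [p] and [q] would be nonempty and balanced, giving two contacts.
    This is what forbids a primitive factor to straddle a junction. *)
Lemma primitive_proper_prefix (m : nat) (p q : seq bool) :
    primitive m (p ++ q) -> p != [::] -> q != [::] ->
  exists h, run m 0 p = Some h.+1.
Proof.
rewrite primitiveE => /andP[bpq /eqP E1] p0 q0.
move: (bpq) => /eqP/run_catI[[|h] Ep Eq]; last by exists h.
have bq : balanced m q by apply/eqP.
have bp : balanced m p by apply/eqP.
move: E1; rewrite balanced_suffixes_cat //.
by move: (balanced_suffixes_gt0 bp) (balanced_suffixes_gt0 bq); lia.
Qed.

(** The shortest nonempty balanced suffix is primitive. *)
Lemma balanced_split_last (m : nat) (w : seq bool) :
    balanced m w -> w != [::] ->
  exists u c, [/\ w = u ++ c, balanced m u & primitive m c].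
Proof.
move=> bw; rewrite -(balanced_suffixes_gt0 bw) => w0.
suff [u [c [Ew pc]]] : exists u c, w = u ++ c /\ primitive m c.
  exists u, c; split=> //.
  by rewrite -(balanced_cat u (primitive_balanced pc)) -Ew.
elim: w {bw} w0 => //= b w IHw.
case: (posnP (balanced_suffixes m w)) => [E0|/IHw[u [c [-> pc]]] _].
  rewrite E0 addn0 lt0b => bw; exists [::], (b :: w); split=> //.
  by rewrite primitiveE /= bw E0.
by exists (b :: u), c.
Qed.

Lemma primitive_head (m : nat) (c : seq bool) : primitive m c ->
  exists2 z, c = true :: z & run m m z = Some 0.
Proof.
rewrite primitiveE; case: c => [|[] z] //= /andP[/eqP Ez _]; by exists z.
Qed.

(* Each displayed letter 0 is the step at which the path started at height h
   first goes negative. *)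
Lemma first_passage_uniq (m h : nat) (u u' v v' : seq bool) :
    run m h u = Some 0 -> run m h u' = Some 0 ->
  u ++ false :: v = u' ++ false :: v' -> u = u' /\ v = v'.
Proof.
elim: u h u' => [|b u IHu] h [|b' u'] //=; first by move=> _ _ [->].
- by case: h => [|h]; case: b'.
- by move=> + [h0] [Eb _]; rewrite h0 Eb.
move=> + + [Eb E]; rewrite -Eb.
case: b {Eb} => [Eu Eu'|]; last case: h => // h Eu Eu'.
  by have [-> ->] := IHu _ _ Eu Eu' E.
by have [-> ->] := IHu _ _ Eu Eu' E.
Qed.

(** The cut is at the first step from height [k.+1] down to [k]. *)
Lemma first_passage (m h k : nat) (w : seq bool) :
    run m (h + k.+1) w = Some 0 ->
  exists u v, [/\ w = u ++ false :: v, run m h u = Some 0 & run m k v = Some 0].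
Proof.
elim: w h => [|[] w IHw] h /=; first by rewrite addnS.
  by rewrite addnAC => /IHw[u [v [-> Eu Ev]]]; exists (true :: u), v.
rewrite addnS; case: h => [|h] Ew; first by exists [::], w.
move: Ew; rewrite addSnnS => /IHw[u [v [-> Eu Ev]]].
by exists (false :: u), v.
Qed.

Lemma cat_eq_cat (T : Type) (a b c d : seq T) : a ++ b = c ++ d ->
  (exists e, a = c ++ e /\ d = e ++ b) \/
  (exists x e, c = a ++ x :: e /\ b = x :: e ++ d).
Proof.
elim: a c => [|x a IHa] [|y c] /=.
- by move=> ->; left; exists [::].
- by move=> ->; right; exists y, c.
- by move=> <-; left; exists (x :: a).
case=> -> /IHa[[e [-> ->]]|[z [e [-> ->]]]]; first by left; exists e.
by right; exists z, e.
Qed.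

(** * Downward closed sets of words and the order [below] *)

Definition down_closed (m : nat) (S : seq bool -> Prop) : Prop :=
  forall w w', rotation m w w' -> S w' -> S w.

(* Impredicative form of the reflexive-transitive closure of rotations. *)
Variant below (m : nat) (w w' : seq bool) : Prop :=
  Below of forall S, down_closed m S -> S w' -> S w.

Lemma down_closedI (m : nat) (S : seq bool -> Prop) :
    (forall u c v, primitive m c ->
       S (u ++ c ++ false :: v) -> S (u ++ false :: c ++ v)) ->
  down_closed m S.
Proof. by move=> SP w w' /rotationP[u [c [v [-> pc ->]]]]; apply: SP. Qed.

Lemma down_closedE (m : nat) (S : seq bool -> Prop) (u c v : seq bool) :
    down_closed m S -> primitive m c ->
  S (u ++ c ++ false :: v) -> S (u ++ false :: c ++ v).
Proof. by move=> cS pc; apply: cS; apply/rotationP; exists u, c, v. Qed.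

Lemma down_closed_run (m h : nat) :
  down_closed m (fun w => run m h w = Some 0).
Proof.
apply: down_closedI => u c v /primitive_balanced bc.
rewrite !run_cat; case: (run m h u) => //= k; rewrite run_cat run_balanced //=.
by case: k => // k; rewrite run_cat (run_balanced _ bc).
Qed.

Lemma down_closed_balanced (m : nat) : down_closed m (balanced m).
Proof. by move=> w w' r /eqP bw; apply/eqP; apply: down_closed_run r bw. Qed.

Lemma down_closed_perm (m : nat) (w : seq bool) :
  down_closed m (fun x => perm_eq x w).
Proof.
apply: down_closedI => u c v _; apply: perm_trans.
by rewrite perm_cat2l -cat_cons -(cat_rcons _ c) perm_cat2r perm_sym perm_rcons.
Qed.

(** The factor [c] followed by 0 lies inside [y], inside [x], or across the junction; heights
    exclude the last case. *)
Lemma down_closed_cat (m h : nat) (S S' : seq bool -> Prop) :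
    (forall x, S x -> run m h x = Some 0) -> (forall y, S' y -> balanced m y) ->
    down_closed m S -> down_closed m S' ->
  down_closed m (fun w => exists x y, [/\ w = x ++ y, S x & S' y]).
Proof.
move=> SP S'P cS cS'; apply: down_closedI => u c v pc [x [y [E Sx S'y]]].
case: (cat_eq_cat E) => [[e [Eu Ey]]|[b [e [Ex {}E]]]].
  exists x, (e ++ false :: c ++ v); split=> //; first by rewrite Eu -catA.
  by apply: (down_closedE cS' pc); rewrite -Ey.
move: E; rewrite -cat_cons => /cat_eq_cat[[f [Ec Ey]]|[b' [f [Ee [Eb Ev]]]]].
  (* Either the balanced word [y] would start with 0, or a proper prefix of [c] would make [x] end
     at a positive height. *)
  case: f Ec Ey => [_ Ey|b' f Ec Ey]; first by move: (S'P _ S'y); rewrite Ey.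
  have [|||k Ek] // := @primitive_proper_prefix m (b :: e) (b' :: f).
    by rewrite -Ec.
  move: (SP _ Sx); rewrite Ex => /run_catI[l _ El].
  by move: (run_add l Ek); rewrite add0n El.
exists (u ++ false :: c ++ f), y; split=> //.
  by rewrite Ev -!catA /= -!catA.
by apply: (down_closedE cS pc); rewrite Eb -Ee -Ex.
Qed.

(** When the moved 0 is the inserted one, it passes back over [c]: [x ++ y] is unchanged and the
    balanced tail grows by [c]. Any other move is already a move of [x ++ y]. *)
Lemma down_closed_insert (m h : nat) (S : seq bool -> Prop) :
    (forall x, S x -> run m h x = Some 0) -> down_closed m S ->
  down_closed m (fun w => exists x y,
    [/\ w = x ++ false :: y, balanced m y & S (x ++ y)]).
Proof.
move=> SP cS; apply: down_closedI => u c v pc [x [y [E bY Sxy]]].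
have [z Ec _] := primitive_head pc.
case: (cat_eq_cat E) => [[[|b e] [Eu Ey]]|[b [e [Ex {}E]]]].
- by move: Ey; rewrite Ec.
- case: Ey => Eb Ey; exists x, (e ++ false :: c ++ v).
  rewrite Eu -Eb -catA; split=> //.
    by apply: (down_closedE (@down_closed_balanced m) pc); rewrite -Ey.
  by rewrite catA; apply: (down_closedE cS pc); rewrite -catA -Ey.
move: E; rewrite -cat_cons => /cat_eq_cat[[f [Ec' Ey]]|[b' [f [Ee [Eb Ev]]]]].
  case: f Ec' Ey => [Ec' [Ey]|b' f Ec' [Eb Ey]].
    exists u, (c ++ v); split=> //.
      by rewrite balanced_cat -?Ey //; apply: primitive_balanced.
    by rewrite -Ey Ec' cats0 catA -Ex.
  have [|||k Ek] // := @primitive_proper_prefix m (b :: e) (b' :: f).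
    by rewrite -Ec'.
  move: (run_catl_balanced bY (SP _ Sxy)); rewrite Ex => /run_catI[l _ El].
  by move: (run_add l Ek); rewrite add0n El.
exists (u ++ false :: c ++ f), y; split=> //.
  by rewrite Ev -!catA /= -!catA.
rewrite -catA /= -catA; apply: (down_closedE cS pc).
by move: Sxy; rewrite Ex Ee -Eb -!catA.
Qed.

(** The first letter never moves: a primitive factor starting there returns to height 0, and a
    following 0 would go below. *)
Lemma down_closed_cons (m : nat) (S : seq bool -> Prop) :
    (forall x, S x -> run m m x = Some 0) -> down_closed m S ->
  down_closed m (fun w => exists2 x, w = true :: x & S x).
Proof.
move=> SP cS; apply: down_closedI => [[|b u] c v pc [x /= E Sx]].
  have [z Ec Ez] := primitive_head pc; move: E (SP _ Sx).
  by rewrite Ec => -[<-]; rewrite run_cat Ez.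
case: E => -> Ex; exists (u ++ false :: c ++ v) => //.
by apply: (down_closedE cS pc); rewrite Ex.
Qed.

Lemma belowE (m : nat) (S : seq bool -> Prop) (w w' : seq bool) :
  down_closed m S -> below m w w' -> S w' -> S w.
Proof. by move=> cS [le_w]; apply: le_w. Qed.

Lemma below_refl (m : nat) (w : seq bool) : below m w w.
Proof. by split. Qed.

Lemma below_rotation (m : nat) (w w' : seq bool) :
  rotation m w w' -> below m w w'.
Proof. by move=> r; split=> S cS; apply: cS. Qed.

Lemma below_trans (m : nat) (w1 w2 w3 : seq bool) :
  below m w1 w2 -> below m w2 w3 -> below m w1 w3.
Proof. by move=> [l12] [l23]; split=> S cS /(l23 S cS)/(l12 S cS). Qed.

(** Rotations act on factors, so the predicate [S (u ++ x ++ v)] in [x] is again downward closed. *)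
Lemma below_ctx (m : nat) (u v w w' : seq bool) :
  below m w w' -> below m (u ++ w ++ v) (u ++ w' ++ v).
Proof.
move=> [lew]; split=> S cS; apply: (lew (fun x => S (u ++ x ++ v))).
apply: down_closedI => u' c v' pc.
by rewrite -!catA /= -!catA ![u ++ u' ++ _]catA; apply: (down_closedE cS pc).
Qed.

Lemma below_cat (m : nat) (u u' v v' : seq bool) :
  below m u u' -> below m v v' -> below m (u ++ v) (u' ++ v').
Proof.
move=> leu lev; have := below_ctx u [::] lev; rewrite !cats0 => lev'.
exact: below_trans lev' (below_ctx [::] v' leu).
Qed.

(** The final 0 moves back over the primitive factors of [v] one at a time, starting with the
    last. *)
Lemma below_insert (m : nat) (u v : seq bool) : balanced m v ->
  below m (u ++ false :: v) (u ++ rcons v false).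
Proof.
elim: (size v) {-2}v (leqnn (size v)) u => [|n IHn] {}v le_v u bv.
  by case: v le_v {bv} => // _; apply: below_refl.
have [->|v0] := eqVneq v [::]; first exact: below_refl.
have [x [c [Ev bx pc]]] := balanced_split_last bv v0.
have le_x : size x <= n.
  move: le_v; rewrite Ev size_cat; have [z -> _] := primitive_head pc.
  by rewrite /= addnS; lia.
have := below_cat (IHn x le_x u bx) (below_refl m c).
rewrite Ev -catA /= => /below_trans; apply; apply: below_rotation.
apply/rotationP; exists (u ++ x), c, [::].
by rewrite cats0 -!cats1 -!catA.
Qed.

Lemma below_run (m h : nat) (w w' : seq bool) :
  below m w w' -> run m h w' = Some 0 -> run m h w = Some 0.
Proof. exact: (belowE (@down_closed_run m h)). Qed.

Lemma below_balanced (m : nat) (w w' : seq bool) :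
  below m w w' -> balanced m w' -> balanced m w.
Proof. exact: (belowE (@down_closed_balanced m)). Qed.

Lemma below_perm (m : nat) (w w' : seq bool) : below m w w' -> perm_eq w w'.
Proof. by move/(belowE (@down_closed_perm m w')); apply. Qed.

(** * Enumerations of lower ideals *)

Definition lower_enum (m : nat) (w : seq bool) (S : seq (seq bool)) : Prop :=
  uniq S /\ forall x, x \in S <-> below m x w.

Lemma lower_enum_closed (m : nat) (w : seq bool) (S : seq (seq bool)) :
  lower_enum m w S -> down_closed m (fun x => x \in S).
Proof.
move=> [_ SP] x y r /SP le_y; apply/SP.
exact: below_trans (below_rotation r) le_y.
Qed.

Lemma lower_enumI (m : nat) (w : seq bool) (S : seq (seq bool)) :
    uniq S -> w \in S -> down_closed m (fun x => x \in S) ->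
    (forall x, x \in S -> below m x w) ->
  lower_enum m w S.
Proof.
move=> uS Sw cS le_w; split=> // x; split=> [/le_w//|le_x].
exact: (belowE cS le_x Sw).
Qed.

Lemma lower_enum_nil (m : nat) : lower_enum m [::] [:: [::]].
Proof.
apply: lower_enumI => // [|x]; last by rewrite inE => /eqP->; apply: below_refl.
by apply: down_closedI => u c v _; rewrite inE => /eqP; case: u; case: c.
Qed.

Lemma down_closed_ext (m : nat) (S S' : seq bool -> Prop) :
  (forall w, S w <-> S' w) -> down_closed m S -> down_closed m S'.
Proof. by move=> SS' cS w w' r /SS' Sw; apply/SS'; apply: cS r Sw. Qed.

(** Words below [w] are permutations of [w], so they share its length, and concatenations are cut in
    only one way. *)
Lemma lower_enum_cat (m h : nat) (w w' : seq bool) (S S' : seq (seq bool)) :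
    run m h w = Some 0 -> balanced m w' ->
    lower_enum m w S -> lower_enum m w' S' ->
  lower_enum m (w ++ w') [seq x ++ y | x <- S, y <- S'].
Proof.
move=> Ew bw' lS lS'; have [uS SP] := lS; have [uS' S'P] := lS'.
have szS x : x \in S -> size x = size w by move/SP/below_perm/perm_size.
apply: lower_enumI.
- apply: allpairs_uniq => // -[x y] [x' y'] /allpairsP[[a b] [/= Sa _ [-> ->]]].
  move=> /allpairsP[[c d] [/= Sc _ [-> ->]]] /eqP.
  by rewrite eqseq_cat ?(szS a) ?(szS c) // => /andP[/eqP-> /eqP->].
- by apply: allpairs_f; [apply/SP | apply/S'P]; apply: below_refl.
- apply: (down_closed_ext _ (@down_closed_cat m h (fun x => x \in S)
                               (fun y => y \in S') _ _ _ _)).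
  + move=> z; split=> [[x [y [-> Sx Sy]]]|/allpairsP[[x y] [Sx Sy ->]]].
      exact: allpairs_f.
    by exists x, y.
  + by move=> x /SP/below_run; apply.
  + by move=> x /S'P/below_balanced; apply.
  + exact: lower_enum_closed lS.
  + exact: lower_enum_closed lS'.
move=> z /allpairsP[[x y] [/SP le_x /S'P le_y ->]]; exact: below_cat.
Qed.

(** Inserts 0 before each balanced suffix. The boolean count in [nseq] gives at most one word, and
    the empty suffix always gives one. *)
Fixpoint insert_step (m : nat) (w : seq bool) : seq (seq bool) :=
  if w is b :: w' then
    nseq (balanced m w) (false :: w) ++ map (cons b) (insert_step m w')
  else [:: [:: false]].

Lemma insert_stepP (m : nat) (w y : seq bool) :
  reflect (exists u v, [/\ w = u ++ v, y = u ++ false :: v & balanced m v])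
          (y \in insert_step m w).
Proof.
elim: w y => [|b w IHw] y /=.
  rewrite inE; apply: (iffP eqP) => [->|]; first by exists [::], [::].
  by case=> [[|? ?] [[|? ?] []]].
rewrite mem_cat mem_nseq lt0b; apply: (iffP orP).
  case=> [/andP[bw /eqP->]|/mapP[z /IHw[u [v [-> -> bv]]] ->]].
    by exists [::], (b :: w).
  by exists (b :: u), v.
case=> [[|a u]] [v [/= Ew -> bv]]; first by left; rewrite Ew bv eqxx.
right; case: Ew => <- Ew; apply/mapP; exists (u ++ false :: v) => //.
by apply/IHw; exists u, v.
Qed.

Lemma insert_step_run (m h : nat) (w y : seq bool) : run m h w = Some 0 ->
  y \in insert_step m w -> run m h.+1 y = Some 0.
Proof.
move=> Ew /insert_stepP[u [v [E -> bv]]]; move: Ew; rewrite E.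
move=> /(run_catl_balanced bv) Eu; rewrite run_cat -addn1 (run_add 1 Eu) /=.
exact: run_balanced.
Qed.

Lemma insert_step_uniq (m : nat) (w : seq bool) : uniq (insert_step m w).
Proof.
elim: w => //= b w IHw; rewrite cat_uniq map_inj_uniq ?IHw => [|x y [//]].
rewrite andbT; have [bw|_] := boolP (balanced m _) => /=; last by apply/hasPn.
apply/hasPn=> _ /mapP[x _ ->]; rewrite inE.
(* A nonempty balanced word starts with 1, so words keeping the head [b] differ from the one
   starting with 0. *)
by case: b bw.
Qed.

(** The inserted 0 is the first step to pass below the final level of [w], so it can be located in
    [y] and removed. *)
Lemma insert_step_disjoint (m h : nat) (w w' y : seq bool) :
    run m h w = Some 0 -> run m h w' = Some 0 ->
  y \in insert_step m w -> y \in insert_step m w' -> w = w'.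
Proof.
move=> Ew Ew' /insert_stepP[u [v [E -> bv]]] /insert_stepP[u' [v' [E' Ey bv']]].
move: Ew Ew'; rewrite E E' => /(run_catl_balanced bv) Eu.
move=> /(run_catl_balanced bv') Eu'.
by have [-> ->] := first_passage_uniq Eu Eu' Ey.
Qed.

Lemma lower_enum_rcons (m h : nat) (w : seq bool) (S : seq (seq bool)) :
    run m h w = Some 0 -> lower_enum m w S ->
  lower_enum m (rcons w false) (flatten (map (insert_step m) S)).
Proof.
move=> Ew lS; have [uS SP] := lS.
have runS x : x \in S -> run m h x = Some 0 by move/SP/below_run; apply.
apply: lower_enumI.
- elim: S {lS SP} uS runS => //= x S IHS /andP[Sx uS] runS.
  rewrite cat_uniq insert_step_uniq IHS //= ?andbT; last first.
    by move=> z Sz; apply: runS; rewrite inE Sz orbT.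
  apply/hasPn=> y /flatten_mapP[x' Sx' yx']; apply: contra Sx => yx.
  rewrite (@insert_step_disjoint m h x x' y) //; apply: runS.
    by rewrite inE eqxx.
  by rewrite inE Sx' orbT.
- apply/flatten_mapP; exists w; first by apply/SP; apply: below_refl.
  by apply/insert_stepP; exists w, [::]; rewrite cats0 cats1.
- apply: (down_closed_ext _ (@down_closed_insert m h
                               (fun x => x \in S) runS _)).
  + move=> z; split=> [[x [y [-> b_y Sxy]]]|/flatten_mapP[x Sx]].
      apply/flatten_mapP; exists (x ++ y) => //.
      by apply/insert_stepP; exists x, y.
    by move/insert_stepP=> [u [v [E -> bv]]]; exists u, v; rewrite -E.
  exact: lower_enum_closed lS.
(* The chain is [u 0 v] below [u v 0], which is below [w 0]. *)
move=> y /flatten_mapP[x /SP le_x /insert_stepP[u [v [E -> bv]]]].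
apply: below_trans (below_insert u bv) _.
by rewrite -rcons_cat -E -!cats1; apply: below_cat le_x (below_refl _ _).
Qed.

Lemma lower_enum_cons (m : nat) (w : seq bool) (S : seq (seq bool)) :
    run m m w = Some 0 -> lower_enum m w S ->
  lower_enum m (true :: w) (map (cons true) S).
Proof.
move=> Ew lS; have [uS SP] := lS.
apply: lower_enumI.
- by rewrite map_inj_uniq // => x y [].
- by apply: map_f; apply/SP; apply: below_refl.
- apply: (down_closed_ext _ (@down_closed_cons m (fun x => x \in S) _ _)).
  + by move=> z; split=> [[x -> Sx]|/mapP[x Sx ->]]; [apply: map_f | exists x].
  + by move=> x /SP/below_run; apply.
  exact: lower_enum_closed lS.
move=> _ /mapP[x /SP le_x ->].
exact: (below_cat (below_refl m [:: true]) le_x).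
Qed.

(** * Generating functions by number of contacts *)

Local Open Scope ring_scope.

(** The exponent is [balanced_suffixes] rather than [returns] because intermediate words may end
    below their starting level. *)
Definition returns_gf (m : nat) (S : seq (seq bool)) : {poly int} :=
  \sum_(w <- S) 'X^(balanced_suffixes m w).

(** Cancelling the nonzero factor ['X - 1] lets [Delta] be handled without computing a quotient. *)
Lemma Delta_unique (f g : {poly int}) :
  f * ('X - 1) = 'X * g - (g.[1])%:P -> Delta g = f.
Proof.
move=> Ef; apply: (@mulIf _ ('X - 1 : {poly int})); last by rewrite DeltaE Ef.
by rewrite -polyC1 polyXsubC_eq0.
Qed.

(** Inserting 0 keeps exactly the contacts of the suffix after it; with k contacts in [w] the sum is
    1 + x + ... + x^k, here multiplied by x - 1 so that it telescopes. *)
Lemma returns_gf_insert (m h : nat) (w : seq bool) : run m h w = Some 0%N ->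
  returns_gf m (insert_step m w) * ('X - 1) =
  'X^((balanced_suffixes m w).+1) - 1.
Proof.
rewrite /returns_gf; elim: w h => [|b w IHw] h Ew.
  by rewrite /= big_seq1 /= expr0 mul1r.
have [h' Ew'] : exists h', run m h' w = Some 0%N.
  by case: b Ew => /=; [exists (h + m)%N | case: h => // h; exists h].
rewrite [insert_step _ _]/= big_cat big_map mulrDl.
(* Since [b :: w] goes from [h] to 0, [b :: y] goes from [h.+1] to 0 and cannot be balanced. *)
have -> : \sum_(y <- insert_step m w) 'X^(balanced_suffixes m (b :: y)) =
    \sum_(y <- insert_step m w) 'X^(balanced_suffixes m y) :> {poly int}.
  apply: eq_big_seq => y yw /=.
  suff -> : balanced m (b :: y) = false by [].
  apply/negP => /eqP by_y.
  move: Ew; case: b by_y => //= by_y Ew; have := insert_step_run Ew yw.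
  by move: (run_add h.+1 by_y); rewrite add0n addnC addSn => ->.
rewrite (IHw _ Ew') /=.
have [bw|_] := boolP (balanced m (b :: w)); last by rewrite big_nil mul0r add0r.
rewrite big_seq1 /= bw add0n add1n !exprS.
by ring.
Qed.

Lemma returns_gf_rcons (m h : nat) (S : seq (seq bool)) :
    (forall x, x \in S -> run m h x = Some 0%N) ->
  returns_gf m (flatten (map (insert_step m) S)) = Delta (returns_gf m S).
Proof.
move=> runS; apply/esym/Delta_unique.
rewrite /returns_gf big_flatten big_map mulr_suml mulr_sumr horner_sum.
rewrite raddf_sum -sumrB; apply: eq_big_seq => x /runS Ex.
by rewrite (returns_gf_insert Ex) -exprS hornerXn expr1n.
Qed.

Lemma returns_gf_cat (m : nat) (S S' : seq (seq bool)) :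
    (forall y, y \in S' -> balanced m y) ->
  returns_gf m [seq x ++ y | x <- S, y <- S'] =
  returns_gf m S * returns_gf m S'.
Proof.
move=> bS'; rewrite /returns_gf big_allpairs_dep mulr_suml.
apply: eq_bigr => x _.
rewrite mulr_sumr; apply: eq_big_seq => y /bS' b_y.
by rewrite balanced_suffixes_cat // exprD.
Qed.

Lemma returns_gf_cons (m : nat) (S : seq (seq bool)) :
    (forall x, x \in S -> run m m x = Some 0%N) ->
  returns_gf m (map (cons true) S) = 'X * returns_gf m S.
Proof.
move=> runS; rewrite /returns_gf big_map mulr_sumr.
apply: eq_big_seq => x /runS Ex.
by rewrite /= /balanced /= Ex eqxx exprS.
Qed.

Local Close Scope ring_scope.

(** * Words of trees *)

(** What follows the letter 1 of a node, for a list of any length, so that subtrees can be added one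
    at a time. *)
Definition forest_word (m : nat) (ts : seq (mtree m)) : seq bool :=
  flatten [seq rcons (word_of t) false | t <- ts].

Lemma word_of_Node (m : nat) (l : mtree m) (r : {ffun 'I_m -> mtree m}) :
  word_of (Node l r) =
  word_of l ++ true :: forest_word [seq r i | i <- rev (enum 'I_m)].
Proof. by rewrite /forest_word -map_comp. Qed.

Lemma balanced_word_of (m : nat) (t : mtree m) : balanced m (word_of t).
Proof. by rewrite /balanced run_word_of. Qed.

Lemma forest_word_rcons (m : nat) (ts : seq (mtree m)) (t : mtree m) :
  forest_word (rcons ts t) = rcons (forest_word ts ++ word_of t) false.
Proof.
by rewrite /forest_word map_rcons -cats1 flatten_cat /= cats0 rcons_cat.
Qed.

Lemma run_forest_word (m : nat) (ts : seq (mtree m)) :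
  run m (size ts) (forest_word ts) = Some 0.
Proof.
elim: ts => //= t ts IHts.
by rewrite /forest_word /= cat_rcons run_cat run_word_of.
Qed.

(** A nonempty forest word ends with a 0 that reaches its final level for the first time. *)
Lemma balanced_suffixes_forest_word (m : nat) (ts : seq (mtree m)) :
  balanced_suffixes m (forest_word ts) = 0.
Proof.
case/lastP: ts => // ts t; rewrite forest_word_rcons -cats1.
apply: (@balanced_suffixes_drop m (size ts)) => //.
by rewrite run_cat run_forest_word /= run_word_of.
Qed.

Lemma primitive_forest_word (m : nat) (ts : seq (mtree m)) :
  size ts = m -> primitive m (true :: forest_word ts).
Proof.
move=> sz; rewrite primitiveE /= balanced_suffixes_forest_word addn0.
suff -> : balanced m (true :: forest_word ts) by [].
by apply/eqP; rewrite /= -(run_forest_word ts) sz.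
Qed.

Lemma size_map_rev_enum (m : nat) (T : Type) (r : 'I_m -> T) :
  size [seq r i | i <- rev (enum 'I_m)] = m.
Proof. by rewrite size_map size_rev size_enum_ord. Qed.

(** Each node of the left branch contributes one primitive factor, its 1 followed by its forest
    word. *)
Lemma balanced_suffixes_word_of (m : nat) (t : mtree m) :
  balanced_suffixes m (word_of t) = lambda t.
Proof.
elim/mtree_ind: t => // l r IHl _; rewrite word_of_Node.
have := primitive_forest_word (size_map_rev_enum r).
rewrite primitiveE => /andP[b_c /eqP E1].
by rewrite balanced_suffixes_cat // E1 IHl addn1.
Qed.

Lemma tree_lower_enum (m : nat) (t : mtree m) :
  exists2 S, lower_enum m (word_of t) S & returns_gf m S = B t.
Proof.
elim/mtree_ind: t => [|l r [Sl lSl gfl] IHr].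
  by exists [:: [::]]; [apply: lower_enum_nil | rewrite /returns_gf big_seq1].
(* The outermost factor of the fold is written last in the word, hence [rev]. Adding [i] appends the
   word of [r i], giving a product, and then 0, giving [Delta]. *)
have forestP s : exists2 S,
    lower_enum m (forest_word [seq r i | i <- rev s]) S &
    returns_gf m S = foldr (fun i g => Delta (B (r i) * g))%R 1%R s.
  elim: s => [|i s [S lS gfS]] /=.
    by exists [:: [::]]; [apply: lower_enum_nil | rewrite /returns_gf big_seq1].
  have [Si lSi gfi] := IHr i.
  rewrite rev_cons map_rcons forest_word_rcons.
  have Es := run_forest_word [seq r i | i <- rev s].
  have lSSi := lower_enum_cat Es (balanced_word_of (r i)) lS lSi.
  have Esi : run m (size [seq r i | i <- rev s])
     (forest_word [seq r i | i <- rev s] ++ word_of (r i)) = Some 0.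
    by rewrite run_cat Es /= run_word_of.
  exists (flatten (map (insert_step m) [seq x ++ y | x <- S, y <- Si])).
    exact: lower_enum_rcons Esi lSSi.
  rewrite (@returns_gf_rcons _ (size [seq r i | i <- rev s])); last first.
    by move=> x; case: lSSi => _ -> /below_run; apply.
  rewrite returns_gf_cat; last first.
    move=> y; case: lSi => _ -> /below_balanced; apply.
    exact: balanced_word_of.
  by rewrite gfS gfi mulrC.
have [S lS gfS] := forestP (enum 'I_m).
have Es := run_forest_word [seq r i | i <- rev (enum 'I_m)].
rewrite size_map_rev_enum in Es.
have lc := lower_enum_cons Es lS.
exists [seq x ++ y | x <- Sl, y <- map (cons true) S].
  rewrite word_of_Node.
  apply: (lower_enum_cat (run_word_of 0 l) _ lSl lc).
  by rewrite /balanced /= add0n Es.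
rewrite returns_gf_cat; last first.
  by move=> y; case: lc => _ -> /below_balanced; apply; apply/eqP.
rewrite returns_gf_cons; last first.
  by move=> x; case: lS => _ -> /below_run; apply.
by rewrite gfl gfS /= mulrCA mulrA.
Qed.

(** * Trees correspond to balanced words *)

(** No primitive word is a proper suffix of another: the part before it would be balanced, yet end
    at a positive height. *)
Lemma primitive_suffix_uniq (m : nat) (u u' c c' : seq bool) :
    primitive m c -> primitive m c' -> u ++ c = u' ++ c' -> u = u' /\ c = c'.
Proof.
have noprefix e d : primitive m d -> primitive m (e ++ d) -> e = [::].
  move=> pd ped; apply/eqP; apply: contraT => e0.
  have [||h Eh] // := primitive_proper_prefix ped.
    by have [z ->] := primitive_head pd.
  move: (primitive_balanced ped).
  by rewrite balanced_cat ?(primitive_balanced pd) // /balanced Eh.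
move=> pc pc' /cat_eq_cat[[e [-> Ec]]|[x [e [-> Ec]]]].
  by move: Ec pc' => -> /(noprefix _ _ pc) ->; rewrite cats0.
by move: pc; rewrite Ec -cat_cons => /(noprefix _ _ pc').
Qed.

(** First passages locate the separating zeros. Injectivity is assumed only on members of [ts], as
    in an induction on trees. *)
Lemma forest_word_inj (m : nat) (ts ts' : seq (mtree m)) :
    (forall t t', t \in ts -> word_of t = word_of t' -> t = t') ->
    size ts = size ts' ->
  forest_word ts = forest_word ts' -> ts = ts'.
Proof.
elim: ts ts' => [|t ts IHts] [|t' ts'] //= inj [sz].
rewrite /forest_word /= !cat_rcons => E.
have [Et Ets] := first_passage_uniq (run_word_of 0 t) (run_word_of 0 t') E.
rewrite (inj _ _ _ Et) ?inE ?eqxx // (IHts ts') // => a a' a_ts.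
by apply: inj; rewrite inE a_ts orbT.
Qed.

Lemma word_of_inj (m : nat) : injective (@word_of m).
Proof.
move=> t; elim/mtree_ind: t => [|l r IHl IHr] [|l' r'] //.
- by move/(congr1 size); rewrite word_of_Node size_cat /= addnS.
- by move/(congr1 size); rewrite word_of_Node size_cat /= addnS.
rewrite !word_of_Node => /(primitive_suffix_uniq
  (primitive_forest_word (size_map_rev_enum r))
  (primitive_forest_word (size_map_rev_enum r'))) [/IHl-> [E]].
congr Node; apply/ffunP=> i.
suff Er : [seq r i | i <- rev (enum 'I_m)] = [seq r' i | i <- rev (enum 'I_m)].
  by move/eq_in_map: Er; apply; rewrite mem_rev mem_enum.
apply: forest_word_inj => //; last by rewrite !size_map_rev_enum.
by move=> t t' /mapP[j _ ->]; apply: IHr.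
Qed.

(** The word is cut at its [j] successive first passages. The length bound on [wP] fits the strong
    induction of [word_of_surj]. *)
Lemma run_forest_wordP (m j : nat) (w : seq bool) :
    (forall v, size v <= size w -> balanced m v ->
       exists t : mtree m, word_of t = v) ->
    run m j w = Some 0 ->
  exists (ts : seq (mtree m)) (t : mtree m),
    size ts = j /\ w = forest_word ts ++ word_of t.
Proof.
elim: j w => [|j IHj] w wP Ew.
  by have [//||t <-] := wP w; [apply/eqP | exists [::], t].
have [u [v [E Eu Ev]]] := @first_passage m 0 j w Ew.
have [|t Et] := wP u _ (introT eqP Eu).
  by rewrite E size_cat leq_addr.
have [|//|ts [t' [sz Ets]]] := IHj v.
  move=> x le_x; apply: wP; rewrite E size_cat /= addnS ltnW // ltnS.
  by rewrite (leq_trans le_x) // leq_addl.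
exists (t :: ts), t'; split; first by rewrite /= sz.
by rewrite E -Et Ets /forest_word /= cat_rcons -catA.
Qed.

Lemma word_of_surj (m : nat) (w : seq bool) :
  balanced m w -> exists t : mtree m, word_of t = w.
Proof.
elim: (size w) {-2}w (leqnn (size w)) => [|n IHn] {}w le_w bw.
  by exists Leaf; case: w le_w {bw}.
have [->|w0] := eqVneq w [::]; first by exists Leaf.
have [u [c [E bu pc]]] := balanced_split_last bw w0.
have [z Ec Ez] := primitive_head pc.
have le_sz : size u + size z <= n.
  by move: le_w; rewrite E size_cat Ec /= addnS.
have [|//|l El] := IHn u; first exact: leq_trans (leq_addr _ _) le_sz.
have [|ts [t [sz Et]]] := run_forest_wordP _ Ez.
  move=> v le_v; apply: IHn; apply: leq_trans le_v _.
  exact: leq_trans (leq_addl _ _) le_sz.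
(* A nonempty remainder would add a contact to the only one of [c]. *)
have t0 : word_of t = [::].
  apply/eqP; rewrite -[_ == _]negbK.
  rewrite -(balanced_suffixes_gt0 (balanced_word_of t)).
  move: pc; rewrite Ec primitiveE /= => /andP[-> ].
  rewrite add1n eqSS Et balanced_suffixes_cat ?balanced_word_of //.
  by rewrite balanced_suffixes_forest_word add0n => /eqP ->.
(* The word lists the last subtree first, hence [rev]; the default [Leaf] is never reached since
   [ts] has size [m]. *)
exists (Node l [ffun i : 'I_m => nth Leaf (rev ts) i]).
rewrite word_of_Node El E Ec Et t0 cats0; congr (_ ++ _ :: forest_word _).
rewrite map_rev -[RHS]revK; congr rev.
rewrite -[RHS](mkseq_nth Leaf) size_rev sz /mkseq -val_enum_ord -map_comp.
by apply: eq_map => i /=; rewrite ffunE.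
Qed.

(** * The tree order and the final count *)

Lemma tree_leP (m n : nat) (t t' : tree_of m n) :
  tree_le t t' <-> below m (word_of t) (word_of t').
Proof.
split.
  rewrite /tree_le /tamari_le => /connectP[p].
  have -> : word_of t' = path_of t' :> seq bool by [].
  have -> : word_of t = path_of t :> seq bool by [].
  move: (path_of t) (path_of t') => D0 D'.
  elim: p D0 => [|D p IHp] D0 /=; first by move=> _ ->; apply: below_refl.
  by move=> /andP[r /IHp{}IHp] /IHp; apply: below_trans; apply: below_rotation.
(* Undoing a rotation of a ballot path of size [n] gives another one, so chains of words lift to
   chains of paths. *)
pose S w := exists2 D : ballot_path m n,
  w = D :> seq bool & tamari_le D (path_of t').
move=> le_t; have [D ED leD] : S (word_of t).
  apply: (belowE _ le_t) => [w w' r [D Ew' leD]|]; last first.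
    by exists (path_of t') => //; apply: connect0.
  have le_w := below_rotation r.
  have /andP[bD cD] : balanced m D && (count_mem true D == n).
    by rewrite -ballot_balanced bvalP.
  have bw : ballot m n w.
    rewrite ballot_balanced (below_balanced le_w) ?Ew' //=.
    by rewrite (permP (below_perm le_w)) Ew'.
  have sz : size w == m * n + n.
    by rewrite (perm_size (below_perm le_w)) Ew' size_tuple.
  exists (@BallotPath m n (Tuple sz) bw) => //.
  by apply: connect_trans leD; apply: connect1; rewrite /= -Ew'.
rewrite /tree_le; suff -> : path_of t = D by [].
by apply/val_inj/val_inj.
Qed.

Local Open Scope ring_scope.

Theorem theorem8p2p2 (m n : nat) (hm : (1 <= m)%N) (T : tree_of m n) :
  [/\ B T = \sum_(T' : tree_of m n | tree_le T' T) 'X^(lambda T'),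
      forall T' : tree_of m n, lambda T' = returns m (path_of T')
    & (B T).[1] = #|[set T' : tree_of m n | tree_le T' T]|%:R].
Proof.
have BE : B T = \sum_(T' : tree_of m n | tree_le T' T) 'X^(lambda T').
  have [S [uS SP] <-] := tree_lower_enum T.
  have perm_S : perm_eq S
      [seq word_of (val T') | T' <- enum [pred T' | tree_le T' T]].
    apply: uniq_perm => //.
      by rewrite map_inj_uniq ?enum_uniq // => x y /word_of_inj/val_inj.
    move=> w; apply/idP/mapP => [/SP le_w|[T' + ->]]; last first.
      by rewrite mem_enum => /tree_leP le_T'; apply/SP.
    (* A word below that of [T] stays balanced and is a permutation of it, so it comes from a tree
       of the same size. *)
    have [t Et] := word_of_surj (below_balanced le_w (balanced_word_of T)).
    have sz : Defs.tsize t == n.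
      rewrite -count_word_of Et (permP (below_perm le_w)) count_word_of.
      exact: tvalP.
    exists (TreeOf sz) => //; rewrite mem_enum; apply/tree_leP.
    by rewrite /= Et.
  rewrite /returns_gf (perm_big _ perm_S) /= big_map big_enum /=.
  by apply: eq_bigr => T' _; rewrite balanced_suffixes_word_of.
split=> //.
  move=> T'; rewrite returns_balanced ?balanced_suffixes_word_of //.
  exact: balanced_word_of.
rewrite BE horner_sum -sum1_card natr_sum.
by apply: eq_big => [T'|T' _]; rewrite ?inE // hornerXn expr1n.
Qed.
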